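(* Let $\mathfrak{H}$ be the Heisenberg group with the Korányi metric $\mathrm{d}_K$, and let $p_1,p_2\in\mathfrak{H}$ be two distinct points which lie on an infinite $\mathbb{C}$-circle. Then the Korányi bisector $$\mathcal{B}(p_1,p_2)=\{p\in\mathfrak{H}\;|\;\mathrm{d}_K(p_1,p)=\mathrm{d}_K(p_2,p)\}$$ is a horizontally minimal surface.
   Context: Heisenberg group and Korányi metric. $\mathfrak{H}$ is the set $\mathbb{C}\times\mathbb{R}$, with coordinates $(z,t)=(x+iy,t)$, and group law $(z,t)*(w,s)=(z+w,\;t+s+2\Im(z\overline{w}))$. The Korányi gauge is $|(z,t)|_K=(|z|^4+t^2)^{1/4}$ and the Korányi metric is the left-invariant metric $\mathrm{d}_K(p,q)=|p^{-1}*q|_K$. Infinite $\mathbb{C}$-circles are the vertical lines $\{z_0\}\times\mathbb{R}\subset\mathfrak{H}$, $z_0\in\mathbb{C}$ (the boundaries, with the point $\infty$ removed, of complex lines of the complex hyperbolic plane whose boundary passes through $\infty$). Horizontal geometry. Consider the left-invariant vector fields $X=\frac{\partial}{\partial x}+2y\frac{\partial}{\partial t}$ and $Y=\frac{\partial}{\partial y}-2x\frac{\partial}{\partial t}$, declared orthonormal for the sub-Riemannian metric. Let $\mathcal{S}=\{F(x,y,t)=0\}$ be a hypersurface in $\mathfrak{H}$, where $F:\mathfrak{H}\to\mathbb{R}$ is $C^2$ with nonvanishing differential on $\mathcal{S}$. Its characteristic locus is $C(\mathcal{S})=\{p\in\mathcal{S}\;|\;X_p(F)=Y_p(F)=0\}$.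 Where $(XF,YF)\neq(0,0)$, the unit horizontal normal is $n^h_{\mathcal{S}}=n_1X+n_2Y$ with $$n_1=\frac{XF}{[(XF)^2+(YF)^2]^{1/2}},\qquad n_2=\frac{YF}{[(XF)^2+(YF)^2]^{1/2}},$$ and the horizontal mean curvature $H^h$ of $\mathcal{S}$ is defined at points of $\mathcal{S}\setminus C(\mathcal{S})$ by $2H^h=X(n_1)+Y(n_2)$. The surface $\mathcal{S}$ is called horizontally minimal if $H^h\equiv 0$, i.e. $H^h=0$ at every point of $\mathcal{S}\setminus C(\mathcal{S})$. *)

(* Defs.v *)
From Stdlib Require Import Reals.
From Coquelicot Require Import Coquelicot.
Open Scope R_scope.

Definition heis : Type := (C * R)%type.

Definition hmul (p q : heis) : heis :=
  (Cplus (fst p) (fst q),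
   snd p + snd q + 2 * Im (Cmult (fst p) (Cconj (fst q)))).

Definition hone : heis := (RtoC 0, 0).

Definition hinv (p : heis) : heis := (Copp (fst p), - snd p).

Lemma hmul_inv_l (p : heis) : hmul (hinv p) p = hone.
Proof.
  destruct p as [[x y] t]; unfold hmul, hinv, hone, RtoC; simpl.
  f_equal; [unfold Cplus, Copp; simpl; f_equal; ring | ring].
Qed.

(* The fourth root is an iterated square root: [Rpower 0 (1/4)] is [1]. *)
Definition koranyi_gauge (p : heis) : R :=
  sqrt (sqrt (Cmod (fst p) ^ 4 + snd p ^ 2)).

Definition dK (p q : heis) : R := koranyi_gauge (hmul (hinv p) q).

Definition bisector (p1 p2 : heis) : heis -> Prop :=
  fun p => dK p1 p = dK p2 p.

Definition infinite_C_circle (L : heis -> Prop) : Prop :=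
  exists z0 : C, forall p : heis, L p <-> exists t : R, p = (z0, t).

(* Coquelicot's [C] is [R * R], so [((x, y), t)] is a point of [heis]. *)
Definition xc (p : heis) : R := Re (fst p).
Definition yc (p : heis) : R := Im (fst p).
Definition tc (p : heis) : R := snd p.

Definition dx (F : heis -> R) (p : heis) : R :=
  Derive (fun x => F ((x, yc p), tc p)) (xc p).
Definition dy (F : heis -> R) (p : heis) : R :=
  Derive (fun y => F ((xc p, y), tc p)) (yc p).
Definition dt (F : heis -> R) (p : heis) : R :=
  Derive (fun t => F ((xc p, yc p), t)) (tc p).

(* [Derive] is total, so existence of the partial derivatives has to be
   required separately from their continuity. *)
Definition C1 (F : heis -> R) : Prop :=
  forall p : heis,
    ex_derive (fun x => F ((x, yc p), tc p)) (xc p) /\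
    ex_derive (fun y => F ((xc p, y), tc p)) (yc p) /\
    ex_derive (fun t => F ((xc p, yc p), t)) (tc p) /\
    continuous (dx F) p /\ continuous (dy F) p /\ continuous (dt F) p.

Definition C2 (F : heis -> R) : Prop :=
  C1 F /\ C1 (dx F) /\ C1 (dy F) /\ C1 (dt F).

Definition X (F : heis -> R) (p : heis) : R := dx F p + 2 * yc p * dt F p.
Definition Y (F : heis -> R) (p : heis) : R := dy F p - 2 * xc p * dt F p.

Definition defining_function (F : heis -> R) (S : heis -> Prop) : Prop :=
  C2 F /\
  (forall p, S p <-> F p = 0) /\
  (forall p, S p -> ~ (dx F p = 0 /\ dy F p = 0 /\ dt F p = 0)).

Definition hypersurface (S : heis -> Prop) : Prop :=
  exists F : heis -> R, defining_function F S.

Definition characteristic_locus (F : heis -> R) (S : heis -> Prop) :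
    heis -> Prop :=
  fun p => S p /\ X F p = 0 /\ Y F p = 0.

Definition n1 (F : heis -> R) (p : heis) : R :=
  X F p / sqrt ((X F p) ^ 2 + (Y F p) ^ 2).
Definition n2 (F : heis -> R) (p : heis) : R :=
  Y F p / sqrt ((X F p) ^ 2 + (Y F p) ^ 2).

Definition horizontal_mean_curvature (F : heis -> R) (p : heis) : R :=
  (X (n1 F) p + Y (n2 F) p) / 2.

(* On the surface the horizontal mean curvature does not depend on the
   defining function up to sign, so its vanishing is a property of [S]; it is
   required for every defining function, and one must exist. *)
Definition horizontally_minimal (S : heis -> Prop) : Prop :=
  hypersurface S /\
  forall F : heis -> R, defining_function F S ->
  forall p : heis, S p -> ~ characteristic_locus F S p ->
  horizontal_mean_curvature F p = 0.

(* Main.v *)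
Require Import Defs.
From Stdlib Require Import Reals.
From Coquelicot Require Import Coquelicot.
From Stdlib Require Import Lra FunctionalExtensionality.

(** If [p1] and [p2] lie over [z0 = x0 + i y0], the bisector is the plane
    [t = c + 2 (y0 x - x0 y)].  For any defining function [F], writing
    [u = x - x0] and [v = y - y0], tangential differentiation gives
    [XF = 2 v F_t] and [YF = - 2 u F_t] on the plane.  The numerator of
    [X n1 + Y n2] only involves the derivative of [(XF, YF)] along [u X + v Y],
    paired with [(u, v)]; that direction is radial and integrates to a straight
    line in the plane, along which [u XF + v YF] vanishes identically. *)

(** * Differentiation along Euclidean lines *)

Definition shift (p v : heis) (s : R) : heis :=
  ((xc p + s * xc v, yc p + s * yc v), tc p + s * tc v).

(** Gateaux differentiability with linear dependence on the direction. It determines the partials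
    and lets sums, products and quotients be handled by one-variable calculus. *)
Definition is_gradient (f : heis -> R) (p : heis) (a b c : R) : Prop :=
  forall v : heis,
    is_derive (fun s => f (shift p v s)) 0 (xc v * a + yc v * b + tc v * c).

Lemma shift_0 (p v : heis) : shift p v 0 = p.
Proof.
  destruct p as [[x y] t]; unfold shift, xc, yc, tc; simpl.
  now rewrite !Rmult_0_l, !Rplus_0_r.
Qed.

(** A first partial that exists everywhere and is continuous at [(x, x)], together with the second
    partial at that point alone, makes [f] differentiable there; the chain rule does the rest. *)
Lemma is_derive_diagonal (f dfx : R -> R -> R) (x dfy : R) :
  (forall s r, is_derive (fun z => f z r) s (dfx s r)) ->
  is_derive (fun z => f x z) x dfy ->
  continuous (fun w : R * R => dfx (fst w) (snd w)) (x, x) ->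
  is_derive (fun s => f s s) x (dfx x x + dfy).
Proof.
  intros Hx Hy Hc.
  assert (D : differentiable_pt_lim f x x (dfx x x) dfy).
  { apply filterdiff_differentiable_pt_lim.
    apply (is_derive_filterdiff f x x dfx dfy); trivial.
    apply filter_forall; intros w; apply Hx. }
  apply is_derive_Reals.
  replace (dfx x x + dfy) with (dfx x x * 1 + dfy * 1) by ring.
  apply (derivable_pt_lim_comp_2d f (fun s => s) (fun s => s)); trivial;
    apply derivable_pt_lim_id.
Qed.

Lemma is_derive_affine_comp (f : R -> R) (a l s d : R) :
  is_derive f (a + s * l) d -> is_derive (fun z => f (a + z * l)) s (l * d).
Proof.
  intros H; apply (is_derive_comp f (fun z => a + z * l)); trivial.
  auto_derive; trivial; ring.
Qed.

Lemma C1_is_derive (f : heis -> R) (x y t : R) :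
  Defs.C1 f ->
  is_derive (fun z => f ((z, y), t)) x (dx f ((x, y), t)) /\
  is_derive (fun z => f ((x, z), t)) y (dy f ((x, y), t)) /\
  is_derive (fun z => f ((x, y), z)) t (dt f ((x, y), t)).
Proof.
  intros H; destruct (H ((x, y), t)) as (Hx & Hy & Ht & _).
  repeat split; apply Derive_correct; assumption.
Qed.

Lemma C1_continuous (f : heis -> R) (p : heis) :
  Defs.C1 f -> continuous (dx f) p /\ continuous (dy f) p /\ continuous (dt f) p.
Proof. intros H; now destruct (H p) as (_ & _ & _ & Hc). Qed.

Lemma continuous_heis_comp (f : heis -> R) (a b c : R * R -> R) (w : R * R) :
  continuous a w -> continuous b w -> continuous c w ->
  continuous f ((a w, b w), c w) ->
  continuous (fun w => f ((a w, b w), c w)) w.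
Proof.
  intros Ha Hb Hc Hf.
  apply (continuous_comp_2 (fun w => (a w, b w) : C) c (fun z t => f (z, t)));
    trivial.
  - apply (continuous_comp_2 a b (fun x y => (x, y) : C)); trivial.
    apply (continuous_ext (fun z : R * R => z)); [now intros [] | ].
    apply continuous_id.
  - apply (continuous_ext f); [now intros [] | exact Hf].
Qed.

Lemma continuous_affine_fst (a l : R) (w : R * R) :
  continuous (fun w : R * R => a + fst w * l) w.
Proof.
  apply (continuous_plus (fun _ : R * R => a) (fun w : R * R => fst w * l)).
  - apply continuous_const.
  - apply (continuous_mult (fun w : R * R => fst w) (fun _ => l)).
    + destruct w; apply continuous_fst.
    + apply continuous_const.
Qed.

Lemma continuous_affine_snd (a l : R) (w : R * R) :
  continuous (fun w : R * R => a + snd w * l) w.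
Proof.
  apply (continuous_plus (fun _ : R * R => a) (fun w : R * R => snd w * l)).
  - apply continuous_const.
  - apply (continuous_mult (fun w : R * R => snd w) (fun _ => l)).
    + destruct w; apply continuous_snd.
    + apply continuous_const.
Qed.

(** Giving separate parameters to the coordinates allows two uses of [is_derive_diagonal]: the first
    splits [x] from [(y, t)], the second [y] from [t]. *)
Lemma C1_is_gradient (f : heis -> R) (p : heis) :
  Defs.C1 f -> is_gradient f p (dx f p) (dy f p) (dt f p).
Proof.
  intros H v; rewrite Rplus_assoc.
  (* The diagonal rule yields partials at coordinates such as [x + 0 * l], that is, at
     [shift p v 0]. *)
  replace (dx f p) with (dx f (shift p v 0)) by now rewrite shift_0.
  replace (dy f p) with (dy f (shift p v 0)) by now rewrite shift_0.
  replace (dt f p) with (dt f (shift p v 0)) by now rewrite shift_0.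
  destruct v as [[l m] n], p as [[x y] t]; unfold shift, xc, yc, tc; simpl.
  apply (is_derive_diagonal
           (fun s r => f ((x + s * l, y + r * m), t + r * n))
           (fun s r => l * dx f ((x + s * l, y + r * m), t + r * n))).
  - intros s r.
    apply (is_derive_affine_comp (fun z => f ((z, y + r * m), t + r * n))).
    exact (proj1 (C1_is_derive f _ _ _ H)).
  - apply (is_derive_diagonal
             (fun s r => f ((x + 0 * l, y + s * m), t + r * n))
             (fun s r => m * dy f ((x + 0 * l, y + s * m), t + r * n))).
    + intros s r.
      apply (is_derive_affine_comp (fun z => f ((x + 0 * l, z), t + r * n))).
      exact (proj1 (proj2 (C1_is_derive f _ _ _ H))).
    + apply (is_derive_affine_comp (fun z => f ((x + 0 * l, y + 0 * m), z))).
      exact (proj2 (proj2 (C1_is_derive f _ _ _ H))).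
    + apply (continuous_mult (fun _ : R * R => m)).
      * apply continuous_const.
      * apply (continuous_heis_comp (dy f) (fun _ => x + 0 * l)
                 (fun w => y + fst w * m) (fun w => t + snd w * n)).
        -- apply continuous_const.
        -- apply continuous_affine_fst.
        -- apply continuous_affine_snd.
        -- exact (proj1 (proj2 (C1_continuous f _ H))).
  - apply (continuous_mult (fun _ : R * R => l)).
    + apply continuous_const.
    + apply (continuous_heis_comp (dx f) (fun w => x + fst w * l)
               (fun w => y + snd w * m) (fun w => t + snd w * n)).
      * apply continuous_affine_fst.
      * apply continuous_affine_snd.
      * apply continuous_affine_snd.
      * exact (proj1 (C1_continuous f _ H)).
Qed.

Lemma is_gradient_partials (f : heis -> R) (p : heis) (a b c : R) :
  is_gradient f p a b c -> dx f p = a /\ dy f p = b /\ dt f p = c.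
Proof.
  intros H; destruct p as [[x y] t].
  (* [K] moves the base point of a coordinate line from parameter [0] to [x0], the form in which
     [Derive] enters the partials. *)
  assert (K : forall (g : R -> R) x0 d,
             is_derive (fun s => g (x0 + s * 1)) 0 d -> Derive g x0 = d).
  { intros g x0 d Hg; apply is_derive_unique.
    apply (is_derive_ext (fun z => g (x0 + (- x0 + z * 1) * 1))).
    { intros z; f_equal; ring. }
    rewrite <- (Rmult_1_l d).
    apply (is_derive_affine_comp (fun s => g (x0 + s * 1)) (- x0) 1).
    now replace (- x0 + x0 * 1) with 0 by ring. }
  unfold dx, dy, dt, xc, yc, tc; simpl.
  repeat split; apply K.
  - replace a with (1 * a + 0 * b + 0 * c) by ring.
    eapply is_derive_ext; [ | apply (H ((1, 0), 0))].
    intros s; unfold shift, xc, yc, tc; simpl; now rewrite !Rmult_0_r, !Rplus_0_r.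
  - replace b with (0 * a + 1 * b + 0 * c) by ring.
    eapply is_derive_ext; [ | apply (H ((0, 1), 0))].
    intros s; unfold shift, xc, yc, tc; simpl; now rewrite !Rmult_0_r, !Rplus_0_r.
  - replace c with (0 * a + 0 * b + 1 * c) by ring.
    eapply is_derive_ext; [ | apply (H ((0, 0), 1))].
    intros s; unfold shift, xc, yc, tc; simpl; now rewrite !Rmult_0_r, !Rplus_0_r.
Qed.

(** * Derivatives of [X F], [Y F] and of the unit normal *)

Lemma X_is_gradient (F : heis -> R) (p : heis) :
  C2 F -> exists a b c, is_gradient (X F) p a b c.
Proof.
  intros (_ & Hx & _ & Ht).
  (* The term [2 * dt F p] in the [y] component comes from differentiating the coefficient [2 * yc]
     of [dt F]. *)
  exists (dx (dx F) p + 2 * yc p * dx (dt F) p),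
    (dy (dx F) p + 2 * yc p * dy (dt F) p + 2 * dt F p),
    (dt (dx F) p + 2 * yc p * dt (dt F) p).
  intros v.
  pose proof (C1_is_gradient _ p Hx v) as Gx.
  pose proof (C1_is_gradient _ p Ht v) as Gt.
  set (gx := xc v * dx (dx F) p + yc v * dy (dx F) p + tc v * dt (dx F) p) in Gx.
  set (gt := xc v * dx (dt F) p + yc v * dy (dt F) p + tc v * dt (dt F) p) in Gt.
  evar_last.
  - apply (is_derive_plus (fun s => dx F (shift p v s))
             (fun s => 2 * (yc p + s * yc v) * dt F (shift p v s))).
    + exact Gx.
    + apply (is_derive_mult (fun s => 2 * (yc p + s * yc v))).
      * auto_derive; trivial.
      * exact Gt.
      * intros; apply Rmult_comm.
  - unfold plus, mult; simpl; rewrite shift_0; unfold gx, gt; ring.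
Qed.

Lemma Y_is_gradient (F : heis -> R) (p : heis) :
  C2 F -> exists a b c, is_gradient (Y F) p a b c.
Proof.
  intros (_ & _ & Hy & Ht).
  exists (dx (dy F) p - 2 * xc p * dx (dt F) p - 2 * dt F p),
    (dy (dy F) p - 2 * xc p * dy (dt F) p),
    (dt (dy F) p - 2 * xc p * dt (dt F) p).
  intros v.
  pose proof (C1_is_gradient _ p Hy v) as Gy.
  pose proof (C1_is_gradient _ p Ht v) as Gt.
  set (gy := xc v * dx (dy F) p + yc v * dy (dy F) p + tc v * dt (dy F) p) in Gy.
  set (gt := xc v * dx (dt F) p + yc v * dy (dt F) p + tc v * dt (dt F) p) in Gt.
  evar_last.
  - apply (is_derive_minus (fun s => dy F (shift p v s))
             (fun s => 2 * (xc p + s * xc v) * dt F (shift p v s))).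
    + exact Gy.
    + apply (is_derive_mult (fun s => 2 * (xc p + s * xc v))).
      * auto_derive; trivial.
      * exact Gt.
      * intros; apply Rmult_comm.
  - unfold minus, plus, opp, mult; simpl; rewrite shift_0; unfold gy, gt; ring.
Qed.

(** With r^2 = A^2 + B^2, the quotient rule gives (a r^2 - A (A a + B b)) / r^3 = B (B a - A b) /
    r^3. Exchanging [A] and [B] covers the other component of the normal. *)
Lemma is_gradient_normalize (A B : heis -> R) (p : heis) (a1 a2 a3 b1 b2 b3 : R) :
  is_gradient A p a1 a2 a3 -> is_gradient B p b1 b2 b3 ->
  0 < A p ^ 2 + B p ^ 2 ->
  let k := B p / sqrt (A p ^ 2 + B p ^ 2) ^ 3 in
  is_gradient (fun q => A q / sqrt (A q ^ 2 + B q ^ 2)) p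
    (k * (B p * a1 - A p * b1)) (k * (B p * a2 - A p * b2))
    (k * (B p * a3 - A p * b3)).
Proof.
  intros HA HB Hpos k v; specialize (HA v); specialize (HB v).
  set (a := xc v * a1 + yc v * a2 + tc v * a3) in HA.
  set (b := xc v * b1 + yc v * b2 + tc v * b3) in HB.
  pose proof (sqrt_lt_R0 _ Hpos) as Hr.
  pose proof (sqrt_sqrt _ (Rlt_le _ _ Hpos)) as Hr2.
  assert (HN : is_derive (fun s => A (shift p v s) ^ 2 + B (shift p v s) ^ 2) 0
                 (2 * A p * a + 2 * B p * b)).
  { evar_last.
    - apply @is_derive_plus; apply is_derive_pow; [exact HA | exact HB].
    - unfold plus; simpl; rewrite shift_0; ring. }
  evar_last.
  - apply (is_derive_div (fun s => A (shift p v s))); [exact HA | | ].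
    + apply is_derive_sqrt; [exact HN | now rewrite shift_0].
    + rewrite shift_0; lra.
  - cbv beta; rewrite shift_0; unfold k.
    replace (xc v * _ + _ + _) with
      (B p / sqrt (A p ^ 2 + B p ^ 2) ^ 3 * (B p * a - A p * b))
      by (unfold a, b; ring).
    set (r := sqrt (A p ^ 2 + B p ^ 2)) in *.
    transitivity ((a * (r * r) - A p * (A p * a + B p * b)) / r ^ 3).
    + field; lra.
    + rewrite Hr2; field; lra.
Qed.

(** * Affine defining functions *)

Definition affine (a b c d : R) (p : heis) : R :=
  a * xc p + b * yc p + c * tc p + d.

Lemma affine_is_gradient (a b c d : R) (p : heis) :
  is_gradient (affine a b c d) p a b c.
Proof.
  intros v; unfold affine, shift, xc, yc, tc; simpl.
  auto_derive; trivial; ring.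
Qed.

(** Writing constants as [affine 0 0 0 e] keeps the family closed under partials, so that [C2]
    reduces to four instances of [C1]. *)
Lemma affine_partials (a b c d : R) :
  dx (affine a b c d) = affine 0 0 0 a /\
  dy (affine a b c d) = affine 0 0 0 b /\
  dt (affine a b c d) = affine 0 0 0 c.
Proof.
  repeat split; apply functional_extensionality; intros p;
    destruct (is_gradient_partials _ _ _ _ _ (affine_is_gradient a b c d p))
      as (Ex & Ey & Et); unfold affine at 2; rewrite ?Ex, ?Ey, ?Et; ring.
Qed.

Lemma affine_C1 (a b c d : R) : Defs.C1 (affine a b c d).
Proof.
  assert (K : forall e p, continuous (affine 0 0 0 e) p).
  { intros e p; apply (continuous_ext (fun _ => e)).
    - intros q; change (e = affine 0 0 0 e q); unfold affine; ring.
    - apply continuous_const. }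
  destruct (affine_partials a b c d) as (Ex & Ey & Et).
  intros p; rewrite Ex, Ey, Et.
  repeat split; try apply K; unfold affine, xc, yc, tc; simpl; auto_derive; trivial.
Qed.

Lemma affine_C2 (a b c d : R) : C2 (affine a b c d).
Proof.
  destruct (affine_partials a b c d) as (Ex & Ey & Et).
  unfold C2; rewrite Ex, Ey, Et.
  exact (conj (affine_C1 _ _ _ _) (conj (affine_C1 _ _ _ _)
           (conj (affine_C1 _ _ _ _) (affine_C1 _ _ _ _)))).
Qed.

(** * The bisector as a plane *)

Lemma dK_vertical_eq (x0 y0 t1 t2 : R) (p : heis) :
  t1 <> t2 ->
  dK ((x0, y0), t1) p = dK ((x0, y0), t2) p <->
  tc p = (t1 + t2) / 2 + 2 * (y0 * xc p - x0 * yc p).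
Proof.
  intros Hne; destruct p as [[x y] t].
  unfold dK, koranyi_gauge, hmul, hinv, xc, yc, tc; simpl fst; simpl snd.
  (* Both centres lie over the same [z0], so the two gauges share [M] and differ only in the
     vertical term. *)
  set (M := Cmod _ ^ 4).
  assert (HM : 0 <= M) by (apply pow_le, Cmod_ge_0).
  simpl Re; simpl Im; set (e := 2 * (- x0 * - y + - y0 * x)).
  replace (2 * (y0 * x - x0 * y)) with (- e) by (unfold e; ring).
  assert (P : forall a, 0 <= M + a ^ 2) by (intros a; pose proof (pow2_ge_0 a); lra).
  split.
  - intros H.
    apply sqrt_inj in H; try apply sqrt_pos.
    apply sqrt_inj in H; try apply P.
    (* The equal squares of [t + e - t1] and [t + e - t2] differ by a multiple of this product. *)
    assert (Z : (t1 - t2) * (t - ((t1 + t2) / 2 - e)) = 0) by nra.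
    apply Rmult_integral in Z; destruct Z; lra.
  (* On the plane the two vertical terms are opposite, hence have equal squares. *)
  - intros ->; do 3 f_equal; field.
Qed.

(** * Vanishing of the curvature on the plane *)

Lemma tilted_plane_minimal (x0 y0 c : R) (S : heis -> Prop) :
  (forall p, S p <-> tc p = c + 2 * (y0 * xc p - x0 * yc p)) ->
  horizontally_minimal S.
Proof.
  intros HS; split.
  (* This is t - c - 2 (y0 x - x0 y); its [t] derivative is 1, so its differential never
     vanishes. *)
  - exists (affine (- 2 * y0) (2 * x0) 1 (- c)).
    split; [apply affine_C2 | split].
    + intros p; rewrite HS; unfold affine; split; intros H; lra.
    + intros p _ (_ & _ & Ht); revert Ht.
      rewrite (proj2 (proj2 (affine_partials _ _ _ _))); unfold affine; lra.
  - intros F (HF & HF0 & Hreg) p Hp Hchar.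
    assert (Hin : forall q v s, S q -> tc v = 2 * (y0 * xc v - x0 * yc v) ->
              S (shift q v s)).
    { intros q v s Hq Hv; apply HS; apply HS in Hq.
      change (tc q + s * tc v =
              c + 2 * (y0 * (xc q + s * xc v) - x0 * (yc q + s * yc v))).
      rewrite Hq, Hv; ring. }
    (* A function that vanishes along a line in the plane has zero derivative in its direction. *)
    assert (tangent : forall f q v a1 a2 a3,
              S q -> tc v = 2 * (y0 * xc v - x0 * yc v) ->
              is_gradient f q a1 a2 a3 -> (forall s, f (shift q v s) = 0) ->
              xc v * a1 + yc v * a2 + tc v * a3 = 0).
    { intros f q v a1 a2 a3 Hq Hv Hg H0.
      rewrite <- (is_derive_unique _ _ _ (Hg v)).
      rewrite (Derive_ext _ (fun _ => 0)) by exact H0; apply Derive_const. }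
    assert (HXY : forall q, S q ->
              X F q = 2 * (yc q - y0) * dt F q /\
              Y F q = - 2 * (xc q - x0) * dt F q).
    { intros q Hq.
      pose proof (C1_is_gradient F q (proj1 HF)) as G.
      assert (T : forall v, tc v = 2 * (y0 * xc v - x0 * yc v) ->
                xc v * dx F q + yc v * dy F q + tc v * dt F q = 0).
      { intros v Hv; apply (tangent F q v); trivial.
        intros s; apply HF0, Hin; trivial. }
      (* These two vectors span the tangent plane and express [dx F] and [dy F] through [dt F]. *)
      pose proof (T ((1, 0), 2 * y0)) as T1.
      pose proof (T ((0, 1), - 2 * x0)) as T2.
      unfold xc, yc, tc in T1, T2; simpl in T1, T2.
      unfold X, Y; split; [specialize (T1 ltac:(ring)) | specialize (T2 ltac:(ring))];
        lra. }
    destruct (X_is_gradient F p HF) as (a1 & a2 & a3 & GA).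
    destruct (Y_is_gradient F p HF) as (b1 & b2 & b3 & GB).
    destruct (HXY p Hp) as (EA & EB).
    assert (Hpos : 0 < X F p ^ 2 + Y F p ^ 2).
    { destruct (Req_dec (X F p) 0) as [ZA | NA].
      - destruct (Req_dec (Y F p) 0) as [ZB | NB].
        + exfalso; apply Hchar; now repeat split.
        + pose proof (pow2_ge_0 (X F p)); pose proof (pow2_gt_0 _ NB); lra.
      - pose proof (pow2_ge_0 (Y F p)); pose proof (pow2_gt_0 _ NA); lra. }
    set (u := xc p - x0) in *; set (v := yc p - y0) in *.
    (* [((u, v), m)] is tangent to the plane and is also u X + v Y at [p], since y u - x v = y0 u -
       x0 v. *)
    set (m := 2 * (y0 * u - x0 * v)).
    assert (radial : u * (u * a1 + v * a2 + m * a3)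
                     + v * (u * b1 + v * b2 + m * b3) = 0).
    { transitivity (u * (u * a1 + v * b1) + v * (u * a2 + v * b2)
                    + m * (u * a3 + v * b3)); [ring | ].
      (* The weights [u] and [v] stay frozen at [p]. At parameter [s] both horizontal offsets are
         scaled by 1 + s, so the two terms cancel by [HXY]. *)
      apply (tangent (fun q => u * X F q + v * Y F q) p ((u, v), m));
        [exact Hp | reflexivity | | ].
      - intros w; evar_last.
        + apply @is_derive_plus; apply is_derive_scal; [apply GA | apply GB].
        + unfold plus; simpl; ring.
      - intros s.
        destruct (HXY (shift p ((u, v), m) s)) as (-> & ->);
          [now apply Hin | ].
        unfold u, v, shift; simpl; unfold xc, yc, tc; simpl; ring. }
    pose proof (is_gradient_normalize _ _ _ _ _ _ _ _ _ GA GB Hpos) as G1.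
    pose proof (is_gradient_normalize _ _ _ _ _ _ _ _ _ GB GA
                  ltac:(now rewrite Rplus_comm)) as G2.
    cbv zeta in G1, G2.
    replace (fun q => Y F q / sqrt (Y F q ^ 2 + X F q ^ 2)) with (n2 F) in G2
      by (apply functional_extensionality; intros q; unfold n2;
          now rewrite (Rplus_comm (X F q ^ 2))).
    rewrite (Rplus_comm (Y F p ^ 2)) in G2.
    change (fun q => X F q / sqrt (X F q ^ 2 + Y F q ^ 2)) with (n1 F) in G1.
    destruct (is_gradient_partials _ _ _ _ _ G1) as (D1x & _ & D1t).
    destruct (is_gradient_partials _ _ _ _ _ G2) as (_ & D2y & D2t).
    unfold horizontal_mean_curvature.
    unfold X at 1, Y at 1; rewrite D1x, D1t, D2y, D2t.
    pose proof (sqrt_lt_R0 _ Hpos) as Hr.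
    set (r := sqrt (X F p ^ 2 + Y F p ^ 2)) in *; rewrite EA, EB.
    (* Substituting [EA] and [EB] extracts 4 (dt F)^2 / r^3, halved by the definition of the
       curvature; the remaining factor is [radial]. *)
    transitivity (2 * dt F p ^ 2 / r ^ 3
                  * (u * (u * a1 + v * a2 + m * a3)
                     + v * (u * b1 + v * b2 + m * b3))).
    + replace (xc p) with (u + x0) by (unfold u; ring).
      replace (yc p) with (v + y0) by (unfold v; ring).
      unfold m; field; lra.
    + rewrite radial; ring.
Qed.

Theorem proposition3p1 (p1 p2 : heis) (L : heis -> Prop)
    (hL : infinite_C_circle L) (h1 : L p1) (h2 : L p2) (hne : p1 <> p2) :
  horizontally_minimal (bisector p1 p2).
Proof.
  destruct hL as [[x0 y0] HL].
  apply HL in h1; destruct h1 as [t1 ->].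
  apply HL in h2; destruct h2 as [t2 ->].
  apply (tilted_plane_minimal x0 y0 ((t1 + t2) / 2)).
  intros p; apply dK_vertical_eq; intros ->; now apply hne.
Qed.
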